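(* Let $k \ge 2$ and $n \in \mathbb{N}$ be integers such that $0 < \lceil k H_n \rceil - k H_n < \frac{1}{n \binom{n-1}{\lfloor n/2 \rfloor}}$. Then $f(n,k) \ge \lceil k H_n \rceil + 1$. In particular, if $n$ is sufficiently large, there are infinitely many positive integers $k$ for which $f(n,k) \ge \lceil k H_n \rceil + 1$.
   Context: $H_n = 1 + \frac12 + \cdots + \frac1n$ is the $n$th harmonic number. Let $Q^n = \{0,1\}^n$. For $k \in \mathbb{N}$, an almost $k$-cover of $Q^n$ is a multiset of affine hyperplanes in $\mathbb{R}^n$, none of which contains the origin, such that every nonzero point of $Q^n$ lies in at least $k$ of the hyperplanes (counted with multiplicity). $f(n,k)$ denotes the minimum size of an almost $k$-cover of $Q^n$. *)

(* Defs.v *)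
From mathcomp Require Import all_boot all_order all_algebra.
From mathcomp Require Import finmap multiset.
From mathcomp Require Import boolp classical_sets cardinality reals.

Set Implicit Arguments.
Unset Strict Implicit.
Unset Printing Implicit Defensive.

Import Order.TTheory GRing.Theory Num.Theory.

Local Open Scope classical_set_scope.
Local Open Scope ring_scope.
Local Open Scope mset_scope.

Definition harmonic_number (R : realType) (n : nat) : R :=
  \sum_(1 <= i < n.+1) i%:R^-1.

Definition cube (R : realType) (n : nat) : set 'rV[R]_n :=
  [set x : 'rV[R]_n | forall i, x 0 i = 0 \/ x 0 i = 1].

Definition affine_hyperplane (R : realType) (n : nat) (H : set 'rV[R]_n) : Prop :=
  exists (a : 'rV[R]_n) (b : R),
    a != 0 /\ H = [set x : 'rV[R]_n | \sum_(i < n) a 0 i * x 0 i = b].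

(* A multiset coerces to the sequence of its elements repeated with
   multiplicity, so [count] and [size] take multiplicities into account. *)
Definition almost_cover (R : realType) (n k : nat)
    (A : {mset set 'rV[R]_n}) : Prop :=
  (forall H : set 'rV[R]_n, H \in A -> affine_hyperplane H /\ ~ H 0) /\
  (forall x : 'rV[R]_n, cube x -> x != 0 -> (k <= count (fun H : set 'rV[R]_n => x \in H) A)%N).

Definition almost_cover_size (R : realType) (n k : nat) : pred nat :=
  fun m => `[< exists A : {mset set 'rV[R]_n}, almost_cover k A /\ size A = m >].

(* The hyperplanes x_i = 1, each taken k times, form an almost k-cover. *)
Lemma almost_cover_size_ex (R : realType) (n k : nat) :
  exists m, almost_cover_size R n k m.
Proof.
pose h (i : 'I_n) := [set x : 'rV[R]_n | x 0 i = 1].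
pose s := flatten [seq nseq k (h i) | i <- enum 'I_n].
exists (size (seq_mset s)); apply/asboolP; exists (seq_mset s); split => //.
have sE := perm_eq_seq_mset s.
split=> [H | x cx x0].
  rewrite (perm_mem sE) => /flatten_mapP[i _] /nseqP[-> _]; split; last first.
    by rewrite /h /= mxE => /esym/eqP; rewrite oner_eq0.
  exists (delta_mx 0 i), 1; split.
    apply/eqP => /rowP/(_ i); rewrite !mxE !eqxx /=.
    by move/eqP; rewrite oner_eq0.
  suff E (x : 'rV[R]_n) : \sum_(j < n) (delta_mx 0 i : 'rV[R]_n) 0 j * x 0 j = x 0 i.
    by apply/seteqP; split=> x /=; rewrite E.
  rewrite (bigD1 i) //= !mxE !eqxx mul1r big1 ?addr0 // => j ji.
  by rewrite !mxE eqxx (negbTE ji) mul0r.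
rewrite (permP sE) count_flatten -map_comp sumnE big_map.
have /existsP[i xi0] : [exists i, x 0 i != 0].
  apply: contra_neqT x0; rewrite negb_exists => /forallP x0.
  by apply/rowP => i; rewrite mxE; apply/eqP; rewrite -[_ == _]negbK.
rewrite (bigD1_seq i) ?mem_enum ?enum_uniq //= count_nseq.
suff -> : x \in h i by rewrite mul1n leq_addr.
by rewrite inE /h /=; case: (cx i) => // xi; rewrite xi eqxx in xi0.
Qed.

Definition min_almost_cover_size (R : realType) (n k : nat) : nat :=
  ex_minn (almost_cover_size_ex R n k).

(* Main.v *)
(* Weigh a nonempty set z of coordinates by (|z| - 1)! (n - |z|)!, that is, by
   the number of orderings of the coordinates that begin with z arranged in one
   out of every |z| rotations.  For a hyperplane a.x = 1, call an ordering good
   if its first prefix of weight >= 1 has weight exactly 1.  By the cycle lemma,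
   a point z of the hyperplane is that first prefix in at least
   (|z| - 1)! (n - |z|)! orderings, so the points of a hyperplane have total
   weight at most n!; as all nonzero points together weigh n! H_n, every almost
   k-cover has size at least k H_n.

   The refinement is that a hyperplane of total weight less than n! misses n! by
   at least the weight of some nonempty set: a minimal prefix y crossing 1
   strictly is crossed strictly in some rotation of each of its cyclic orders,
   and if there is no such prefix, a point that is counted too often is counted
   at least twice in each of its cyclic orders.  An overcovered point also costs
   at least its own weight.  Hence the size of a cover is k H_n or exceeds it by
   at least the least weight divided by n!, which is 1 / (n C(n-1, n/2)).

   For infinitely many k the gap between k H_n and its ceiling is 1 / q with q the
   denominator of H_n, so it remains to see that q > n C(n-1, n/2) for large n.
   Integrating (x (1 - x) (1 - 2 x)) ^ (2 j) over [0, 1] shows that lcm(1, ..., n)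
   is at least about 108 ^ (n / 6), all large primes p > n / 24 divide q, and the
   part of lcm(1, ..., n) on the remaining primes is at most
   4 ^ (n / 24) n ^ sqrt n. *)
Require Import Defs.
From mathcomp Require Import all_boot all_order all_algebra.
From mathcomp Require Import zify ring lra polyrcf.

Set Implicit Arguments.
Unset Strict Implicit.
Unset Printing Implicit Defensive.

Import Order.TTheory GRing.Theory Num.Theory.

Local Open Scope ring_scope.

(** * The cycle lemma *)

Lemma count_rot_permutations (T : eqType) (P : pred (seq T)) (s : seq T) r :
  count (fun t => P (rot r t)) (permutations s) = count P (permutations s).
Proof.
rewrite -(count_map (rot r) P); apply/permP/uniq_perm.
- by rewrite map_inj_uniq ?permutations_uniq //; apply: rot_inj.
- exact: permutations_uniq.
move=> t; rewrite mem_permutations; apply/mapP/idP => [[u]|ts].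
  by rewrite mem_permutations => us ->; rewrite perm_rot.
by exists (rotr r t); rewrite ?rotrK // mem_permutations perm_rotr.
Qed.

Lemma sum_nat_seq_const (I : Type) (s : seq I) c :
  (\sum_(i <- s) c = c * size s)%N.
Proof. by rewrite big_const_seq count_predT iter_addn_0. Qed.

Lemma leq_sum_seq (I : eqType) (s : seq I) (F G : I -> nat) :
  {in s, forall i, F i <= G i}%N -> (\sum_(i <- s) F i <= \sum_(i <- s) G i)%N.
Proof. by move=> h; rewrite big_seq [leqRHS]big_seq leq_sum. Qed.

(** Exchange the two sums: for each fixed r, rotation by r permutes the orderings of [s]. *)
Lemma sum_count_rot (T : eqType) (P : pred (seq T)) (s : seq T) :
  (\sum_(t <- permutations s) count (fun r => P (rot r t)) (iota 0 (size s)) =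
   size s * count P (permutations s))%N.
Proof.
have countE U (Q : pred U) l : count Q l = (\sum_(x <- l) Q x)%N.
  by rewrite -sumn_count sumnE big_map.
under eq_bigr do rewrite countE.
rewrite exchange_big /= (eq_bigr (fun=> count P (permutations s))) => [|r _]; last first.
  by rewrite -(countE _ (fun t => P (rot r t))) count_rot_permutations.
by rewrite sum_nat_seq_const size_iota mulnC.
Qed.

(** Averaging over cyclic orders: c good rotations among the [size s] rotations of every ordering
    make up a fraction c / [size s] of all orderings. *)
Lemma leq_count_rot (T : eqType) (P : pred (seq T)) (s : seq T) c :
  uniq s -> s != [::] ->
  (forall t, perm_eq t s ->
     c <= count (fun r => P (rot r t)) (iota 0 (size s)))%N ->
  (c * (size s).-1`! <= count P (permutations s))%N.
Proof.
move=> us s0 h; have ss : (0 < size s)%N by case: (s) s0.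
rewrite -(leq_pmul2l ss) -sum_count_rot mulnCA.
rewrite -[X in (_ * (X * _))%N](prednK ss) -factS (prednK ss).
rewrite -size_permutations // -sum_nat_seq_const.
rewrite leq_sum_seq // => t; rewrite mem_permutations => /h //.
Qed.

Lemma count_rot_gt1 (T : eqType) (P : pred (seq T)) (s : seq T) :
  uniq s -> s != [::] -> ((size s).-1`! < count P (permutations s))%N ->
  exists2 t, perm_eq t s &
    (1 < count (fun r => P (rot r t)) (iota 0 (size s)))%N.
Proof.
move=> us s0 h; have ss : (0 < size s)%N by case: (s) s0.
have /hasP[t] : has (fun t => 1 < count (fun r => P (rot r t)) (iota 0 (size s)))%N
    (permutations s).
  apply: contraLR h => /hasPn h; rewrite -leqNgt -(leq_pmul2l ss) -sum_count_rot.
  rewrite -[X in (_ <= X * _)%N](prednK ss) -factS (prednK ss).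
  rewrite -size_permutations // -[leqRHS]mul1n -sum_nat_seq_const.
  by apply: leq_sum_seq => t /h; rewrite -leqNgt.
by rewrite mem_permutations => ts; exists t.
Qed.

Lemma count_gt1_iota (P : pred nat) n : (1 < count P (iota 0 n))%N ->
  exists r1 r2, [/\ (r1 < r2)%N, (r2 < n)%N, P r1 & P r2].
Proof.
rewrite -size_filter; set l := filter _ _ => l2.
have sl : sorted ltn l by rewrite sorted_filter ?iota_ltn_sorted //; apply: ltn_trans.
have inl i : (i < size l)%N -> (P (nth 0 l i) && (nth 0 l i < n))%N.
  by move=> /(mem_nth 0%N); rewrite mem_filter mem_iota.
have /andP[P0 _] := inl 0%N (ltnW l2); have /andP[P1 l1] := inl 1%N l2.
exists (nth 0 l 0)%N, (nth 0 l 1)%N; split=> //.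
by case: (l) l2 sl => // a [|b l'] //= _ /andP[].
Qed.

Lemma count_gt0_iota (P : pred nat) n r : (r < n)%N -> P r ->
  (0 < count P (iota 0 n))%N.
Proof. by move=> rn Pr; rewrite -has_count; apply/hasP; exists r; rewrite ?mem_iota. Qed.

Lemma gt1_count_iota (P : pred nat) n r1 r2 : (r1 < n)%N -> (r2 < n)%N ->
  r1 != r2 -> P r1 -> P r2 -> (1 < count P (iota 0 n))%N.
Proof.
move=> h1 h2 ne p1 p2; rewrite -size_filter.
rewrite (@uniq_leq_size _ [:: r1; r2]) //= ?inE ?ne // => x.
by rewrite !inE mem_filter mem_iota => /orP[]/eqP->; rewrite ?p1 ?p2.
Qed.

(** * Orderings, partial sums and the cycle lemma *)

Section Orders.
Variables (R : realFieldType) (T : finType) (a : T -> R).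
Implicit Types (z y : {set T}) (s t : seq T).

Definition weight (s : seq T) : R := \sum_(x <- s) a x.
Definition setw (z : {set T}) : R := \sum_(x in z) a x.

(* The order is listed backwards: dropping the head removes the element that
   was added last. *)
Fixpoint below (s : seq T) : bool :=
  if s is _ :: t then (weight t < 1) && below t else true.

Definition nbelow (z : {set T}) : nat := count below (permutations (enum z)).

Lemma weight_nil : weight [::] = 0.
Proof. by rewrite /weight big_nil. Qed.

Lemma weight_cons x s : weight (x :: s) = a x + weight s.
Proof. by rewrite /weight big_cons. Qed.

Lemma weight_cat s t : weight (s ++ t) = weight s + weight t.
Proof. by rewrite /weight big_cat. Qed.

Lemma weight_take_drop k s : weight (take k s) + weight (drop k s) = weight s.
Proof. by rewrite -weight_cat cat_take_drop. Qed.

Lemma weight_rot k s : weight (rot k s) = weight s.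
Proof. by rewrite /rot weight_cat addrC weight_take_drop. Qed.

Lemma weight_perm s t : perm_eq s t -> weight s = weight t.
Proof. by move=> st; apply: perm_big. Qed.

Lemma setw0 : setw set0 = 0.
Proof. by rewrite /setw big_set0. Qed.

Lemma setw_seq s : uniq s -> setw [set x in s] = weight s.
Proof.
by move=> us; rewrite /setw /weight big_uniq //; apply: eq_bigl => x; rewrite inE.
Qed.

Lemma weight_enum z : weight (enum z) = setw z.
Proof. by rewrite /weight big_enum. Qed.

Lemma setwD1 z e : e \in z -> setw z = a e + setw (z :\ e).
Proof. by move=> ez; rewrite /setw (big_setD1 e). Qed.

Lemma setwU1 z e : e \notin z -> setw (e |: z) = a e + setw z.
Proof. by move=> ez; rewrite /setw big_setU1. Qed.

Lemma setwD z y : z \subset y -> setw y = setw z + setw (y :\: z).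
Proof. by move=> zy; rewrite /setw (big_setID z) /= (setIidPr zy). Qed.

Lemma weight_take_rot r j s : (r <= size s)%N -> (j <= size s)%N ->
  weight (take j (rot r s)) =
  if (r + j <= size s)%N then weight (take (r + j) s) - weight (take r s)
  else weight s - weight (take r s) + weight (take (r + j - size s) s).
Proof.
move=> rs js; rewrite /rot take_cat size_drop.
have -> : weight s - weight (take r s) = weight (drop r s).
  by rewrite -(weight_take_drop r s) addrAC subrr add0r.
case: ltnP => h1; case: ifP => h2; try lia.
- by rewrite takeD weight_cat addrAC subrr add0r.
- have -> : (j - (size s - r) = 0)%N by lia.
  have -> : (r + j = size s)%N by lia.
  rewrite take0 cats0 take_size -(weight_take_drop r s); lra.
- rewrite weight_cat take_takel; last lia.
  by congr (_ + weight (take _ _)); lia.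
Qed.

Lemma belowP s :
  reflect (forall j, (0 < j <= size s)%N -> weight (drop j s) < 1) (below s).
Proof.
elim: s => [|x s IH] /=; first by apply: ReflectT => j; lia.
apply: (iffP andP) => [[h /IH hs] [|j] //= js|h].
  case: j js => [|j] js; first by rewrite drop0.
  exact: hs.
split; first by have := h 1%N; rewrite /= drop0; apply.
by apply/IH => j js; apply: (h j.+1); lia.
Qed.

(** What remains after dropping j elements is below 1 exactly when the dropped elements outweigh the
    total minus 1. This turns [below] into a condition on partial sums from the front, which
    rotations control. *)
Lemma below_take s :
  (forall j, (0 < j <= size s)%N -> weight s - 1 < weight (take j s)) -> below s.
Proof.
move=> h; apply/belowP => j /h; rewrite -(weight_take_drop j s); lra.
Qed.

Lemma below_gt s j : below s -> (0 < j <= size s)%N ->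
  weight s - 1 < weight (take j s).
Proof.
move=> /belowP h /h; have := weight_take_drop j s; lra.
Qed.

Lemma last_argmin (F : nat -> R) m n : (m < n)%N ->
  exists2 k, (m <= k < n)%N &
    (forall j, (m <= j < n)%N -> F k <= F j) /\
    (forall j, (k < j < n)%N -> F k < F j).
Proof.
elim: n => // n IH; rewrite ltnS leq_eqVlt => /orP[/eqP<-|mn].
  exists m; first lia.
  by split=> j hj; [have -> : j = m by lia | lia].
have [k kmn [h1 h2]] := IH mn; have [le|lt] := leP (F n) (F k).
  exists n; first lia.
  split=> j hj; last lia.
  have [->//|jn] := eqVneq j n; apply: le_trans le (h1 _ _); lia.
exists k; first lia.
split=> j hj; have [->//|jn] := eqVneq j n; first exact: ltW.
  by apply: h1; lia.
by apply: h2; lia.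
Qed.

(** Rotate to the last minimum of the partial sums. A prefix that stops before the end of [s] is
    positive because the minimum is the last one; one that reaches the end or wraps around is at
    least the total because it is a minimum. *)
Lemma rot_prefix_pos s : s != [::] ->
  exists2 r, (r < size s)%N &
    forall j, (0 < j <= size s)%N ->
      0 < weight (take j (rot r s)) \/ weight s <= weight (take j (rot r s)).
Proof.
move=> s0; have ss : (0 < size s)%N by case: (s) s0.
have [r rs [h1 h2]] := last_argmin (fun k => weight (take k s)) ss.
exists r => // j js; rewrite weight_take_rot; [|lia..].
have := h1 0%N; rewrite ss take0 weight_nil => /(_ isT) r0.
case: leqP => h.
  have [e|ne] := eqVneq (r + j)%N (size s).
    by right; rewrite e take_size; lra.
  by left; rewrite subr_gt0; apply: h2; lia.
right; have := h1 (r + j - size s)%N; rewrite leq0n /= => /(_ _) hh.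
have : weight (take r s) <= weight (take (r + j - size s) s) by apply: hh; lia.
lra.
Qed.

Lemma exists_below_rot s : s != [::] -> weight s <= 1 ->
  exists2 r, (r < size s)%N & below (rot r s).
Proof.
move=> s0 s1; have [r rs h] := rot_prefix_pos s0; exists r => //.
apply: below_take => j; rewrite size_rot weight_rot => /h[]; lra.
Qed.

Lemma nbelow_ge z : z != set0 -> setw z <= 1 -> (#|z|.-1`! <= nbelow z)%N.
Proof.
move=> z0 z1; rewrite cardE -[X in (X <= _)%N]mul1n.
have s0 : enum z != [::].
  by apply: contra z0 => /eqP/nilP; rewrite /nilp -cardE cards_eq0.
apply: leq_count_rot; rewrite ?enum_uniq // => t ts.
have t0 : t != [::] by apply: contra s0 => /eqP e; rewrite -size_eq0 -(perm_size ts) e.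
have [|r rs hr] := exists_below_rot t0; first by rewrite (weight_perm ts) weight_enum.
by rewrite -(perm_size ts); apply: (@count_gt0_iota (fun r => below (rot r t)) _ r).
Qed.

Lemma nbelow_set0 : nbelow set0 = 1%N.
Proof. by rewrite /nbelow enum_set0. Qed.

(** The orderings are classified by their head, the element added last. *)
Lemma nbelowE z : z != set0 ->
  nbelow z = (\sum_(x in z) if (setw (z :\ x) < 1)%R then nbelow (z :\ x) else 0)%N.
Proof.
move=> z0; have ss : (0 < size (enum z))%N by rewrite -cardE card_gt0.
rewrite /nbelow (permP (permutationsE ss)) undup_id ?enum_uniq //.
rewrite count_flatten sumnE big_map big_map big_enum /=.
apply: eq_bigr => x xz; rewrite count_map.
have pz : perm_eq (rem x (enum z)) (enum (z :\ x)).
  apply: uniq_perm; rewrite ?rem_uniq ?enum_uniq // => y.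
  by rewrite mem_rem_uniq ?enum_uniq // !inE !mem_enum !inE.
rewrite -(permP (perm_permutations pz)).
have E : {in permutations (rem x (enum z)),
    preim (cons x) below =1 predI (fun=> setw (z :\ x) < 1) below}.
  move=> t; rewrite mem_permutations => tp /=.
  by rewrite (weight_perm tp) (weight_perm pz) weight_enum.
rewrite (eq_in_count E); case: ifP => _; first by apply: eq_count.
by rewrite (eq_count (_ : _ =1 pred0)) // count_pred0.
Qed.

End Orders.

(** * Counting all orderings by their first prefix reaching 1 *)

Section Conservation.
Variables (R : realFieldType) (T : finType) (a : T -> R).
Implicit Types (z y : {set T}) (s t : seq T).
Local Notation setw := (setw a).
Local Notation nbelow := (nbelow a).

(** Both sides count pairs of an ordering of [T] and a nonempty prefix whose proper prefixes all
    weigh less than 1: the left side by that prefix, the right side by the prefix without its last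
    element. *)
Lemma sum_nbelow_step :
  (\sum_(z : {set T} | z != set0) nbelow z * (#|T| - #|z|)`! =
   \sum_(z | (z != setT) && (setw z < 1)%R) nbelow z * (#|T| - #|z|)`!)%N.
Proof.
pose f z := if (setw z < 1)%R then nbelow z else 0%N.
have -> : (\sum_(z : {set T} | z != set0) nbelow z * (#|T| - #|z|)`! =
    \sum_(z : {set T}) \sum_(x in z) f (z :\ x) * (#|T| - #|z|)`!)%N.
  rewrite [RHS](bigD1 set0) //= big_set0 add0n.
  by apply: eq_bigr => z z0; rewrite nbelowE // big_distrl.
rewrite (exchange_big_dep xpredT) //=.
have -> : (\sum_x \sum_(z : {set T} | x \in z) f (z :\ x) * (#|T| - #|z|)`! =
   \sum_x \sum_(z : {set T} | x \notin z) f z * (#|T| - #|z|.+1)`!)%N.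
  apply: eq_bigr => x _.
  rewrite (reindex_onto (fun z => x |: z) (fun z => z :\ x)) /= => [|z xz]; last first.
    by rewrite setD1K.
  have E z : (x \in x |: z) && ((x |: z) :\ x == z) = (x \notin z).
    rewrite setU11 /=; apply/idP/idP => [/eqP<-|xz]; first by rewrite !inE eqxx.
    by rewrite setU1K.
  rewrite (eq_bigl _ _ E); apply: eq_bigr => z xz.
  by rewrite setU1K // cardsU1 xz.
rewrite (exchange_big_dep xpredT) //= [RHS]big_mkcond /=; apply: eq_bigr => z _.
rewrite sum_nat_const /f.
have -> : #|[pred x | x \notin z]| = (#|T| - #|z|)%N.
  by rewrite -[in RHS](setCK z) -cardsCs; apply: eq_card => x; rewrite !inE.
have [->|zT] := eqVneq z setT; first by rewrite cardsT subnn.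
have zc : (#|z| < #|T|)%N by rewrite -cardsT proper_card // properT.
case: ifP => _ //=; last by rewrite muln0.
by rewrite mulnCA subnS -[X in (_ * (X * _))%N](@prednK (#|T| - #|z|)) ?subn_gt0 // -factS prednK ?subn_gt0.
Qed.

(* Every ordering of [T] stays below 1 or has a first prefix reaching 1. *)
Lemma sum_nbelow : (0 < #|T|)%N ->
  ((if (setw setT < 1)%R then nbelow setT else 0) +
   \sum_(z | (1 <= setw z)%R) nbelow z * (#|T| - #|z|)`! = #|T|`!)%N.
Proof.
move=> T0; have := sum_nbelow_step.
have T00 : set0 != [set: T] by rewrite eq_sym -card_gt0 cardsT.
(* In [sum_nbelow_step] the sets of weight below 1 that are neither empty nor full occur on both
   sides and cancel; the empty set contributes all n! orderings on the right. *)
rewrite (bigID (fun z => 1 <= setw z)) /= [RHS](bigD1 set0) /=; last first.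
  by rewrite T00 setw0 ltr01.
rewrite nbelow_set0 cards0 subn0 mul1n.
rewrite (eq_bigl (fun z => 1 <= setw z)) => [|z]; last first.
  by case: eqP => [->|]; rewrite ?setw0 // ler10.

set A := (X in (X + _ = _)%N -> _).
rewrite (bigID (fun z => z == setT)) /=.
rewrite (eq_bigl (fun z => (z == setT) && (setw setT < 1))) => [|z]; last first.
  by case: (eqVneq z setT) => [->|]; rewrite ?andbF //= eq_sym T00 -ltNge andbT.
set B := (X in (_ + (_ + X) = _)%N -> _); set C := (X in (_ = _ + X)%N -> _).
have -> : B = C.
  apply: eq_bigl => z; rewrite -ltNge; case: (z == set0); rewrite ?andbF //=.
  by rewrite andbT andbC.
suff -> : (\sum_(i | (i == setT) && (setw setT < 1)%R) nbelow i * (#|T| - #|i|)`! =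
  if (setw setT < 1)%R then nbelow setT else 0)%N by lia.
case: ifP => _; last by rewrite big1 // => i; rewrite andbF.
rewrite (eq_bigl (pred1 setT)) => [|i]; last by rewrite andbT.
by rewrite big_pred1_eq cardsT subnn muln1.
Qed.

End Conservation.

Lemma rot_rot_modn (T : Type) (s : seq T) m n : (m < size s)%N -> (n < size s)%N ->
  rot m (rot n s) = rot ((m + n) %% size s) s.
Proof.
move=> ms ns; rewrite rot_add_mod; [|lia..].
have [h|h] := leqP (m + n) (size s).
  have [->|ne] := eqVneq (m + n)%N (size s); first by rewrite modnn rot_size rot0.
  by rewrite modn_small //; lia.
by rewrite -{2}(subnK (ltnW h)) modnDr modn_small //; lia.
Qed.

(** * The cycle lemma for minimal sets crossing 1 strictly *)

Section MinimalCrossing.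
Variables (R : realFieldType) (T : finType) (a : T -> R).
Implicit Types (z y : {set T}) (s t : seq T).
Local Notation setw := (setw a).
Local Notation weight := (weight a).
Local Notation below := (below a).
Local Notation nbelow := (nbelow a).

Definition prefix_pos s :=
  forall j, (0 < j <= size s)%N -> 0 < weight (take j s).

Lemma exists_prefix_pos_rot s : s != [::] -> 0 < weight s ->
  exists2 r, (r < size s)%N & prefix_pos (rot r s).
Proof.
move=> s0 ws; have [r rs h] := rot_prefix_pos a s0; exists r => // j.
rewrite size_rot => /h[]//; exact: lt_le_trans.
Qed.

(* [y] is an inclusion-minimal set that some ordering reaches from a prefix of
   weight below 1 by jumping strictly over 1, and [e0] is the jump. *)
Section Minimal.
Variables (y : {set T}) (e0 : T).
Hypothesis hy : [/\ e0 \in y, 1 < setw y, setw (y :\ e0) < 1 &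
  forall z e, z \proper y -> e \in z -> 1 < setw z -> 1 <= setw (z :\ e)].
Let d := setw y - 1.

(** If z weighed strictly between 0 and d, its complement c in [y] would weigh more than 1, so by
    minimality each e in c weighs less than d, whereas [e0] weighs more than d. Then [y] without e
    still exceeds 1, so minimality keeps it at least 1 after removing [e0], which forces e to have
    negative weight. Summed over c this contradicts the weight of c. *)
Lemma minimal_gap z : z \proper y -> 0 < setw z -> d <= setw z.
Proof.
have [e0y y1 ye0 ymin] := hy.
move=> zy z0; rewrite leNgt; apply/negP => zd.
have dE : setw y = 1 + d by rewrite /d; lra.
have ae0 := setwD1 a e0y.
have cE := setwD a (proper_sub zy); set c := y :\: z in cE.
have cy : c \proper y.
  rewrite properE subsetDl /=; apply/negP => /subsetP yc.
  suff e : z = set0 by rewrite e setw0 ltxx in z0.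
  apply/setP => x; rewrite inE; apply/negbTE/negP => xz.
  by have := yc x (subsetP (proper_sub zy) x xz); rewrite !inE xz.
clearbody c; suff : setw c <= 0 by lra.
apply: sumr_le0 => e ec; have ey := subsetP (proper_sub cy) e ec.
have h1 := ymin _ _ cy ec; have h2 := setwD1 a ec.
have {}h1 : 1 <= setw (c :\ e) by apply: h1; lra.
have ne : e0 != e by apply/negP => /eqP e0e; subst e; lra.
have h3 := setwD1 a ey.
have pe : y :\ e \proper y by rewrite properD1.
have h4 := ymin _ e0 pe; rewrite !inE ne e0y in h4.
have {}h4 : 1 <= setw (y :\ e :\ e0) by apply: h4 => //; lra.
have ey0 : e \in y :\ e0 by rewrite !inE eq_sym ne.
have := setwD1 a ey0; rewrite setDDl setUC -setDDl; lra.
Qed.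

Lemma minimal_facts s : perm_eq s (enum y) ->
  [/\ uniq s, weight s = 1 + d, s =i y & forall k, (0 < k < size s)%N ->
    0 < weight (take k s) -> d <= weight (take k s)].
Proof.
have [e0y y1 ye0 ymin] := hy.
move=> sy; have us : uniq s by rewrite (perm_uniq sy) enum_uniq.
have sy' : s =i y by move=> x; rewrite (perm_mem sy) mem_enum.
split=> //; first by rewrite (weight_perm a sy) weight_enum /d; lra.
move=> k ks; rewrite -setw_seq ?take_uniq //; apply: minimal_gap.
rewrite properEcard; apply/andP; split.
  by apply/subsetP => x; rewrite inE => /mem_take; rewrite sy'.
rewrite cardsE (card_uniqP (take_uniq _ us)) size_takel; last lia.
have <- : size s = #|y| by rewrite (perm_size sy) -cardE.
by case/andP: ks.
Qed.

(** Take the last minimum of the proper partial sums. By [minimal_gap] it is at least d, and if it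
    exceeded d the ordering would be [below]. Past this block, the prefixes that stop before the end
    are positive because the minimum is the last one, and the others weigh at least 1. *)
Lemma minimal_block s : perm_eq s (enum y) -> prefix_pos s -> ~~ below s ->
  exists k, [/\ (0 < k < size s)%N, weight (take k s) = d &
    prefix_pos (rot k s)].
Proof.
have [e0y y1 ye0 ymin] := hy.
move=> sy sp nb; have [us ws ys gap] := minimal_facts sy.
have s1 : (1 < size s)%N.
  have : (0 < size s)%N by rewrite (perm_size sy) -cardE card_gt0; apply/set0Pn; exists e0.
  case E : (size s) => [|[|n]] // _; case/negP: nb; apply: below_take => j js.
  have -> : j = size s by lia.
  by rewrite take_size; lra.
have [k ks [h1 h2]] := last_argmin (fun k => weight (take k s)) s1.
have wk : weight (take k s) = d.
  apply/eqP; rewrite eq_le (gap k) ?andbT //; last by apply: sp; lia.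
  rewrite leNgt; apply: contra nb => wk; apply: below_take => j js.
  have [->|ne] := eqVneq j (size s); first by rewrite take_size; lra.
  have := h1 j _; rewrite ws => h; have {}h : weight (take k s) <= weight (take j s).
    by apply: h; lia.
  lra.
exists k; split=> // j; rewrite size_rot => js; rewrite weight_take_rot; [|lia..].
case: leqP => kj.
  have [->|ne] := eqVneq (k + j)%N (size s); first by rewrite take_size; lra.
  by have := h2 (k + j)%N; rewrite subr_gt0; apply; lia.
have : 0 < weight (take (k + j - size s) s) by apply: sp; lia.
lra.
Qed.

(* If the last prefix of weight [d] avoids [e0], rotate past it, which brings
   [e0] closer to the front.  Otherwise that prefix and the next block of weight
   [d] are disjoint, and [e0] together with the rest of [y] contradicts
   minimality. *)
Lemma minimal_below_rot m s : perm_eq s (enum y) -> prefix_pos s ->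
  (index e0 s < m)%N -> exists2 r, (r < size s)%N & below (rot r s).
Proof.
have [e0y y1 ye0 ymin] := hy.
elim: m s => // m IH s sy sp im.
have ss : (0 < size s)%N.
  by rewrite (perm_size sy) -cardE card_gt0; apply/set0Pn; exists e0.
have [bs|nb] := boolP (below s); first by exists 0%N; rewrite ?rot0.
have [us ws ys gap] := minimal_facts sy.
have [k [ks wk tp]] := minimal_block sy sp nb.
have ty : perm_eq (rot k s) (enum y) by rewrite perm_rot.
have [e0k|e0k] := boolP (e0 \in take k s); last first.
  have [|r rs br] := IH _ ty tp.
    rewrite /rot index_cat; have := ys e0; rewrite e0y -{1}(cat_take_drop k s) mem_cat.
    rewrite (negbTE e0k) /= => ->.
    move: im; rewrite -{1}(cat_take_drop k s) index_cat (negbTE e0k) size_takel; last by case/andP: ks => _ /ltnW.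
    by move=> h; rewrite -ltnS (leq_ltn_trans _ h) // -add1n leq_add2r; case/andP: ks.
  move: br; rewrite size_rot in rs; rewrite rot_rot_modn //; last lia.
  by exists ((r + k) %% size s)%N => //; rewrite ltn_mod.
have [bt|nbt] := boolP (below (rot k s)); first by exists k; rewrite //; lia.
have [k' [ks' wk' _]] := minimal_block ty tp nbt; rewrite size_rot in ks'.
(* A second block that wrapped around would weigh 1 plus a prefix of weight at least d, which is
   more than d. *)
have kk : (k + k' <= size s)%N.
  rewrite leqNgt; apply/negP => kk; move: wk'; rewrite weight_take_rot; [|lia..].
  rewrite leqNgt kk /=; have := sp (k + k' - size s)%N; have := gap (k + k' - size s)%N.
  set W := weight (take (k + k' - size s) s) => h1 h2.
  have {h2} h2 : 0 < W by apply: h2; lia.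
  have {h1} h1 : d <= W by apply: h1 => //; lia.
  lra.
(* The remainder [v] after both blocks weighs 1 - d. Adding [e0], which weighs more than d, gives a
   proper subset of [y] that crosses 1 strictly at [e0]. *)
exfalso; set v := drop (k + k') s.
have uv : uniq v by apply: drop_uniq.
have wv : weight v = 1 - d.
  have := weight_take_drop a (k + k') s; rewrite -/v.
  move: wk'; rewrite weight_take_rot; [|lia..]; rewrite kk; lra.
have e0v : e0 \notin v.
  move: us; rewrite -(cat_take_drop (k + k') s) cat_uniq => /and3P[_ /hasPn h _].
  apply/negP => /h /negP; apply.
  by rewrite takeD mem_cat e0k.
have e0v' : e0 \notin [set x in v] by rewrite inE.
have zy : e0 |: [set x in v] \proper y.
  rewrite properEcard; apply/andP; split.
    apply/subsetP => x; rewrite !inE => /orP[/eqP->//|/mem_drop].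
    by rewrite ys.
  have <- : size s = #|y| by rewrite (perm_size sy) -cardE.
  by rewrite cardsU1 e0v' cardsE (card_uniqP uv) size_drop; lia.
have := ymin _ _ zy (setU11 _ _).
rewrite setU1K // setwU1 // setw_seq // wv.
have := setwD1 a e0y; rewrite -/d; have : setw y = 1 + d by rewrite /d; lra.
have d0 : 0 < d by rewrite /d; lra.
move=> e1 e2 h; have {h} : 1 <= 1 - d by apply: h; lra.
lra.
Qed.

(** This is the bound of [nbelow_ge] for a set of weight above 1: every cyclic order is first
    rotated to have positive prefixes and then to be [below]. *)
Lemma minimal_nbelow_ge : (#|y|.-1`! <= nbelow y)%N.
Proof.
have [e0y y1 ye0 ymin] := hy.
rewrite cardE -[X in (X <= _)%N]mul1n; have s0 : enum y != [::].
  by apply/negP => /eqP e; have := mem_enum y e0; rewrite e e0y.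
apply: leq_count_rot; rewrite ?enum_uniq // => t ty.
have t0 : t != [::] by apply: contra s0 => /eqP e; rewrite -size_eq0 -(perm_size ty) e.
have [_ wt _ _] := minimal_facts ty; have d0 : 0 < d by rewrite /d; lra.
have [|r rs tp] := exists_prefix_pos_rot t0; first lra.
have ry : perm_eq (rot r t) (enum y) by rewrite perm_rot.
have [r' rs' br] := minimal_below_rot ry tp (ltnSn _); rewrite size_rot in rs'.
rewrite -(perm_size ty).
apply: (@count_gt0_iota (fun r => below (rot r t)) _ ((r' + r) %% size t)%N).
  by rewrite ltn_mod (leq_ltn_trans _ rs).
by rewrite -rot_rot_modn.
Qed.

End Minimal.
End MinimalCrossing.

(** * The dichotomy for a single hyperplane *)

Section LubellDichotomy.
Variables (R : realFieldType) (T : finType) (a : T -> R).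
Implicit Types (z y : {set T}) (s t : seq T).
Local Notation setw := (setw a).
Local Notation weight := (weight a).
Local Notation below := (below a).
Local Notation nbelow := (nbelow a).

(** At total weight 1, [below] follows from positive prefixes. One such rotation comes from the
    cycle lemma. The other starts at the last minimum of its nonempty partial sums: this minimum is
    less than 1 because the first element is, so it is not attained at the full length. *)
Lemma lt1_two_rots s : s != [::] -> weight s = 1 -> {in s, forall e, a e < 1} ->
  (1 < count (fun r => below (rot r s)) (iota 0 (size s)))%N.
Proof.
move=> s0 ws lt1; have [|r rs sp] := exists_prefix_pos_rot (a := a) s0.
  by rewrite ws ltr01.
have us : weight (rot r s) = 1 by rewrite weight_rot.
have zt : size (rot r s) = size s by rewrite size_rot.
have lt1' : {in rot r s, forall e, a e < 1} by move=> e; rewrite mem_rot; apply: lt1.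
have ss : (0 < size s)%N by case: (s) s0.
have ss1 : (1 < (size s).+1)%N by [].
have [k ks [h1 h2]] := last_argmin (fun k => weight (take k (rot r s))) ss1.
have w1 : weight (take 1 (rot r s)) < 1.
  case: (rot r s) zt lt1' => [/= z0|x t _ h]; first by rewrite -z0 in ss.
  by rewrite /= take0 weight_cons weight_nil addr0 h // inE eqxx.
have wk : weight (take k (rot r s)) < 1.
  by apply: le_lt_trans w1; apply: h1.
have k_lt : (k < size s)%N.
  rewrite ltn_neqAle; apply/andP; split; last by case/andP: ks.
  by apply/eqP => kE; move: wk; rewrite kE -zt take_size us ltxx.
have k_gt : (0 < k)%N by case/andP: ks.
apply: (@gt1_count_iota _ _ r ((k + r) %% size s)%N); rewrite ?ltn_mod //.
- apply/eqP => e; have : (k + r == 0 + r %[mod size s])%N by rewrite add0n (modn_small rs) -e.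
  by rewrite eqn_modDr mod0n modn_small // => /eqP k0; rewrite k0 in k_gt.
- by apply: below_take => j js; rewrite us subrr; apply: sp.
rewrite -rot_rot_modn //; apply: below_take => j.
rewrite weight_rot us subrr size_rot zt => js.
rewrite weight_take_rot ?zt; [|exact: ltnW|by case/andP: js].
case: leqP => kj; first by rewrite subr_gt0; apply: h2; lia.
have : 0 < weight (take (k + j - size s) (rot r s)) by apply: sp; rewrite zt; lia.
rewrite us; lra.
Qed.

(** Two good rotations of one cyclic order cut it into two arcs of weight strictly between 0 and 1.
    An element of weight at least 1 in one arc, added to the other arc, would cross 1 strictly,
    which is excluded. So all elements weigh less than 1, and [lt1_two_rots] applies to every cyclic
    order. *)
Lemma excess_nbelow z :
  (forall y e, e \in y -> 1 < setw y -> 1 <= setw (y :\ e)) ->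
  setw z = 1 -> (#|z|.-1`! < nbelow z)%N -> (2 * #|z|.-1`! <= nbelow z)%N.
Proof.
move=> nobad z1 gz; have s0 : enum z != [::].
  apply/negP => /eqP e; move: z1; rewrite -weight_enum e weight_nil => /eqP.
  by rewrite eq_sym oner_eq0.
rewrite cardE in gz *.
have [t tz /count_gt1_iota[r1 [r2 [r12 r2t b1 b2]]]] :=
  count_rot_gt1 (enum_uniq _) s0 gz.
rewrite -(perm_size tz) in r2t.
pose s := rot r1 t; pose r := (r2 - r1)%N.
have zs : size s = size t by rewrite size_rot.
have r0 : (0 < r)%N by rewrite subn_gt0.
have rs : (r < size s)%N by rewrite zs; apply: leq_ltn_trans r2t; apply: leq_subr.
have rE : rot r2 t = rot r s.
  by rewrite /s -rotD /r ?subnK //; apply: ltnW.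
have tm : t =i z by move=> x; rewrite (perm_mem tz) mem_enum.
have ut : uniq t by rewrite (perm_uniq tz) enum_uniq.
have us : uniq s by rewrite rot_uniq.
have wt : weight t = 1 by rewrite (weight_perm a tz) weight_enum.
have ws : weight s = 1 by rewrite weight_rot.
have sm : s =i z by move=> x; rewrite mem_rot tm.
rewrite rE in b2; change (is_true (below s)) in b1; clearbody s.
have w0 : 0 < weight (take r s).
  by have := below_gt b1 (j := r); rewrite ws subrr r0; apply; apply: ltnW.
have w1 : 0 < weight (drop r s).
  have := below_gt b2 (j := size s - r); rewrite weight_rot ws subrr.
  rewrite (_ : rot r s = drop r s ++ take r s) // -(size_drop r s) take_size_cat // => h.
  by apply: h; rewrite size_drop subn_gt0 rs size_cat size_drop leq_addr.
have w01 := weight_take_drop a r s; rewrite ws in w01.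
have lt1 u e : uniq u -> e \notin u -> 0 < weight u < 1 -> a e < 1.
  move=> uu eu /andP[u0 u1].
  have eu' : e \notin [set x in u] by rewrite inE.
  have h := nobad (e |: [set x in u]) e (setU11 _ _).
  rewrite setU1K // setwU1 // setw_seq // in h.
  rewrite ltNge; apply/negP => a1.
  have {h} : 1 <= weight u by apply: h; lra.
  lra.
have ae e : e \in z -> a e < 1.
  move=> ez; have : e \in take r s ++ drop r s by rewrite cat_take_drop sm.
  move: us; rewrite -{1}(cat_take_drop r s) cat_uniq => /and3P[ut' /hasPn hd ud].
  rewrite mem_cat => /orP[et|ed].
    by apply: (lt1 (drop r s)) => //; [apply/negP => /hd /negP | lra].
  by apply: (lt1 (take r s)) => //; [exact: hd | lra].
apply: leq_count_rot => // [|t' tz']; first exact: enum_uniq.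
rewrite -(perm_size tz'); apply: lt1_two_rots.
- by apply: contra s0 => /eqP e; rewrite -size_eq0 -(perm_size tz') e.
- by rewrite (weight_perm a tz') weight_enum.
- by move=> e; rewrite (perm_mem tz') mem_enum; apply: ae.
Qed.

Definition lubell_weight z : nat := #|z|.-1`! * (#|T| - #|z|)`!.

(* The orderings of [T] whose first prefix of weight at least 1 has weight
   exactly 1 account for the left-hand side; a defect is charged to a set [y]
   all of whose cyclic orders produce uncounted orderings. *)
Lemma lubell_dichotomy : (0 < #|T|)%N ->
  let W := (\sum_(z | setw z == 1%R) lubell_weight z)%N in
  W = #|T|`! \/ exists2 y, y != set0 & (W + lubell_weight y <= #|T|`!)%N.
Proof.
move=> T0 W; have cons := sum_nbelow a T0.
pose c z := (nbelow z * (#|T| - #|z|)`!)%N.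
have Wle z : setw z = 1 -> (lubell_weight z <= c z)%N.
  move=> z1; rewrite leq_mul2r nbelow_ge ?orbT ?z1 //.
  by apply/eqP => e; move: z1; rewrite e setw0 => /eqP; rewrite eq_sym oner_eq0.
have split1 : (\sum_(z | (1 <= setw z)%R) c z =
    \sum_(z | setw z == 1%R) c z + \sum_(z | (1 < setw z)%R) c z)%N.
  rewrite (bigID (fun z => setw z == 1)) /=; congr (_ + _)%N; apply: eq_bigl => z.
    by case: eqP => [->|]; rewrite ?lexx ?andbF.
  by rewrite lt_def andbC.
have Wc : (W <= \sum_(z | setw z == 1%R) c z)%N by apply: leq_sum => z /eqP /Wle.
have [T1|T1] := ltP (setw setT) 1.
  (* The whole set weighs less than 1, and its [below] orderings, which never reach 1, are the
     loss. *)
  right; exists setT; first by rewrite -card_gt0 cardsT.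
  rewrite -cons T1 -/(c _) split1 addnC leq_add ?(leq_trans Wc) ?leq_addr //.
  rewrite /lubell_weight cardsT subnn muln1 -cardsT nbelow_ge ?ltW //.
  by rewrite -card_gt0 cardsT.
rewrite ltNge T1 /= add0n split1 in cons.
have [/existsP[y0 y0bad]|nobad] := boolP [exists y : {set T},
    (1 < setw y) && [exists e in y, setw (y :\ e) < 1]].
  right.
  have [y] := @arg_minnP _ y0 (fun y => (1 < setw y) && [exists e in y, setw (y :\ e) < 1])
    (fun y => #|y|) y0bad.
  move=> /andP[y1 /exists_inP[e0 e0y ye0]] ymin; exists y.
    by apply/set0Pn; exists e0.
  rewrite -cons leq_add // (bigD1 y) //= -[leqLHS]addn0 leq_add // leq_mul2r.
  rewrite (@minimal_nbelow_ge _ _ _ y e0) ?orbT //; split=> // z e zy ez z1.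
  rewrite leNgt; apply/negP => ze; have := proper_card zy; rewrite ltnNge ymin //.
  by rewrite z1; apply/exists_inP; exists e.
have {}nobad y e : e \in y -> 1 < setw y -> 1 <= setw (y :\ e).
  move=> ey y1; rewrite leNgt; apply: contra nobad => ye.
  by apply/existsP; exists y; rewrite y1; apply/exists_inP; exists e.
(* Without strict crossings, a set heavier than 1 already weighs at least 1 before its last element,
   so it is never a first prefix reaching 1. *)
have c0 : (\sum_(z | (1 < setw z)%R) c z = 0)%N.
  apply: big1 => z z1; rewrite /c nbelowE.
    by rewrite big1 // => x xz; rewrite ltNge nobad.
  by apply/eqP => e; move: z1; rewrite e setw0 ltr10.
rewrite c0 addn0 in cons.
have [/existsP[z /andP[/eqP z1 gz]]|ngz] := boolP [exists z : {set T},
    (setw z == 1) && (#|z|.-1`! < nbelow z)%N].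
  right; exists z; first by apply/eqP => e; move: z1; rewrite e setw0 => /eqP; rewrite eq_sym oner_eq0.
  have g2 := excess_nbelow nobad z1 gz.
  rewrite -cons /W (bigD1 z) /= ?z1 // [leqRHS](bigD1 z) /= ?z1 //.
  rewrite addnAC leq_add //; last by apply: leq_sum => x /andP[/eqP /Wle].
  by rewrite addnn -mul2n mulnA leq_mul2r g2 orbT.
left; rewrite -cons; apply: eq_bigr => z /eqP z1; apply/eqP.
rewrite eqn_leq Wle //= leq_mul2r; apply/orP; right; rewrite leqNgt.
by apply: contra ngz => gz; apply/existsP; exists z; rewrite z1 eqxx.
Qed.

End LubellDichotomy.

(** * Weights of the points of a cover *)

Lemma leq_bin_succ m i : (i.*2 < m)%N -> ('C(m, i) <= 'C(m, i.+1))%N.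
Proof.
move=> h; rewrite -(@leq_pmul2l i.+1) // mul_bin_left leq_mul2r.
by apply/orP; right; lia.
Qed.

Lemma leq_bin_half m i : ('C(m, i) <= 'C(m, m./2))%N.
Proof.
have low j : (j <= m./2)%N -> ('C(m, j) <= 'C(m, m./2))%N.
  move: {2}(m./2 - j)%N (leqnn (m./2 - j)) => d; elim: d j => [|d IH] j jd jm.
    by have -> : j = m./2 by lia.
  have [->//|ne] := eqVneq j m./2.
  by apply: leq_trans (leq_bin_succ _) (IH _ _ _); lia.
have [/low//|mi] := leqP i m./2.
have [im|mi'] := leqP i m; last by rewrite bin_small.
by rewrite -bin_sub //; apply: low; lia.
Qed.

Lemma bin_uphalf m : 'C(m, uphalf m) = 'C(m, m./2).
Proof. by rewrite -bin_sub; [congr 'C(_, _); lia | lia]. Qed.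

Section Weights.
Variable T : finType.
Implicit Types z y : {set T}.

(** With n = [#|T|], the quotient of n! by the weight of z is n C(n - 1, |z| - 1), which is largest
    at the middle binomial coefficient. *)
Lemma fact_le_lubell_weight z : z != set0 ->
  (#|T|`! <= lubell_weight z * (#|T| * 'C(#|T|.-1, #|T|./2)))%N.
Proof.
rewrite -card_gt0 /lubell_weight; have := max_card (mem z).
case: #|z| => // i; case: #|T| => // n; rewrite ltnS /= => ni _.
rewrite subSS -/(uphalf n) bin_uphalf factS mulnCA leq_mul2l /=.
by rewrite -(bin_fact ni) mulnC leq_mul2l leq_bin_half orbT.
Qed.

Lemma sum_card_set (F : nat -> nat) :
  (\sum_(z : {set T}) F #|z| = \sum_(i < #|T|.+1) 'C(#|T|, i) * F i)%N.
Proof.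
rewrite (partition_big (fun z => inord #|z| : 'I_#|T|.+1) xpredT) //=.
apply: eq_bigr => i _; rewrite -card_draws -sum1dep_card big_distrl /=.
have E z : (inord #|z| == i) = (#|z| == i :> nat).
  by rewrite -val_eqE /= inordK // ltnS max_card.
by rewrite (eq_bigl _ _ E); apply: eq_bigr => z /eqP->; rewrite mul1n.
Qed.

(** The sets of size i contribute C(n, i) (i - 1)! (n - i)! = n! / i. *)
Lemma sum_lubell_weight (R : numFieldType) :
  (\sum_(z : {set T} | z != set0) lubell_weight z)%:R =
  #|T|`!%:R * \sum_(1 <= i < #|T|.+1) i%:R^-1 :> R.
Proof.
pose F i := if i is j.+1 then (j`! * (#|T| - i)`!)%N else 0%N.
have -> : (\sum_(z : {set T} | z != set0) lubell_weight z =
    \sum_(z : {set T}) F #|z|)%N.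
  rewrite big_mkcond; apply: eq_bigr => z _.
  rewrite -card_gt0 /lubell_weight; by case: #|z|.
rewrite sum_card_set big_ord_recl muln0 add0n big_add1 big_mkord /=.
rewrite natr_sum mulr_sumr; apply: eq_bigr => i _; rewrite /bump add1n.
rewrite -(bin_fact (ltn_ord i)) factS; apply: (canRL (mulfK _)).
  by rewrite pnatr_eq0.
by rewrite -natrM; congr _%:R; rewrite -!mulnA; congr (_ * _)%N; rewrite mulnA mulnC mulnA.
Qed.

End Weights.

(** * Weighted double counting over a cover *)

Section Cover.
Variables (R : realFieldType) (T : finType) (I : eqType).
Variables (A : seq I) (inc : I -> {set T} -> bool) (k : nat).
Implicit Types z y : {set T}.

(** Sum the weights of all incidences by hyperplane and by point. Slack comes either from a
    hyperplane of total weight below n!, through [lubell_dichotomy], or from a point covered more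
    than [k] times; without either, both estimates are equalities. *)
Lemma lubell_cover : (0 < #|T|)%N ->
  {in A, forall H, exists a : T -> R, forall z, inc H z = (setw a z == 1)} ->
  (forall z, z != set0 -> k <= count (inc^~ z) A)%N ->
  let W := (\sum_(z : {set T} | z != set0) lubell_weight z)%N in
  (size A * #|T|`! = k * W)%N \/
  exists2 y : {set T}, y != set0 & (k * W + lubell_weight y <= size A * #|T|`!)%N.
Proof.
move=> T0 hA cov W.
pose V (H : I) := (\sum_(z : {set T} | inc H z) @lubell_weight T z)%N.
have dich H : H \in A -> V H = #|T|`! \/
    exists2 y : {set T}, y != set0 & (V H + lubell_weight y <= #|T|`!)%N.
  move=> /hA[a ha]; have := lubell_dichotomy a T0.
  by rewrite /= (eq_bigl (inc H)) // => z; rewrite ha.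
have Vle H : H \in A -> (V H <= #|T|`!)%N.
  by move=> /dich[->//|[y _]]; apply: leq_trans; apply: leq_addr.
have inc0 H : H \in A -> ~~ inc H set0.
  by move=> /hA[a ->]; rewrite setw0 eq_sym oner_eq0.
have sumV : (\sum_(H <- A) V H =
    \sum_(z : {set T} | z != set0) lubell_weight z * count (inc^~ z) A)%N.
  rewrite big_seq (eq_bigr (fun H => \sum_(z : {set T} | z != set0)
    lubell_weight z * inc H z)%N) => [|H HA].
    rewrite -big_seq exchange_big /=; apply: eq_bigr => z _.
    by rewrite -big_distrr -sumn_count sumnE big_map.
  rewrite /V [LHS]big_mkcond [RHS]big_mkcond; apply: eq_bigr => z _.
  by case: eqP => [->|_]; rewrite ?(negbTE (inc0 _ HA)) //; case: inc; rewrite ?muln1 ?muln0.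
have kW : (k * W = \sum_(z : {set T} | z != set0) lubell_weight z * k)%N.
  by rewrite mulnC big_distrl.
have kle : (k * W <= \sum_(H <- A) V H)%N.
  by rewrite kW sumV leq_sum // => z z0; rewrite leq_mul2l cov ?orbT.
have sE : (size A * #|T|`! = \sum_(H <- A) #|T|`!)%N.
  by rewrite sum_nat_seq_const mulnC.
have [/allP allV|/allPn[H HA HV]] := boolP (all (fun H => V H == #|T|`!) A); last first.
  have [e|[y y0 Vy]] := dich H HA; first by rewrite e eqxx in HV.
  right; exists y => //; apply: leq_trans (leq_add kle (leqnn _)) _.
  rewrite sE (big_rem H) //= [leqRHS](big_rem H) //= addnAC leq_add //.
  by apply: leq_sum_seq => H' /mem_rem /Vle.
have {}sE : (size A * #|T|`! = \sum_(H <- A) V H)%N.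
  by rewrite sE big_seq [RHS]big_seq; apply: eq_bigr => H /allV /eqP.
have [/existsP[y /andP[y0 ky]]|ncov] := boolP [exists y : {set T},
    (y != set0) && (k < count (inc^~ y) A)%N].
  right; exists y => //; rewrite sE sumV kW (bigD1 y) //= [leqRHS](bigD1 y) //=.
  rewrite addnAC leq_add //; first by rewrite addnC -mulnS leq_mul2l ky orbT.
  by apply: leq_sum => z /andP[z0 _]; rewrite leq_mul2l cov ?orbT.
left; rewrite sE sumV kW; apply: eq_bigr => z z0; congr (_ * _)%N.
apply/eqP; rewrite eqn_leq cov // andbT leqNgt.
by apply: contra ncov => kz; apply/existsP; exists z; rewrite z0.
Qed.

End Cover.

(** * The denominators of the harmonic numbers *)

Definition lcm_upto n := \big[lcmn/1%N]_(1 <= i < n.+1) i.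

Lemma lcm_uptoS n : lcm_upto n.+1 = lcmn (lcm_upto n) n.+1.
Proof. by rewrite /lcm_upto big_nat_recr. Qed.

Lemma lcm_upto_gt0 n : (0 < lcm_upto n)%N.
Proof.
elim: n => [|n IH]; first by rewrite /lcm_upto big_nil.
by rewrite lcm_uptoS lcmn_gt0 IH.
Qed.

Lemma leq_lcm_upto m n : (m <= n)%N -> (lcm_upto m <= lcm_upto n)%N.
Proof.
move=> mn; rewrite -(subnK mn); elim: (n - m)%N => // d; rewrite addSn lcm_uptoS => IH.
by apply: leq_trans IH _; rewrite dvdn_leq ?dvdn_lcml // lcmn_gt0 lcm_upto_gt0.
Qed.

Lemma dvdn_lcm_upto i n : (0 < i <= n)%N -> (i %| lcm_upto n)%N.
Proof.
elim: n => [|n IH]; first lia.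
rewrite lcm_uptoS; have [->|ne] := eqVneq i n.+1; first by rewrite dvdn_lcmr.
by move=> h; apply: dvdn_trans (IH _) (dvdn_lcml _ _); lia.
Qed.

(** * A lower bound for lcm(1, ..., n) by integration *)

Section Antiderivative.
Variable R : rcfType.
Implicit Types Q : {poly R}.

Definition antideriv Q : {poly R} :=
  \sum_(i < size Q) (Q`_i / i.+1%:R) *: 'X^(i.+1).

Lemma deriv_antideriv Q : (antideriv Q)^`() = Q.
Proof.
rewrite /antideriv raddf_sum -[RHS]coefK poly_def; apply: eq_bigr => i _.
rewrite /= derivZ derivXn -scaler_nat scalerA divfK //.
by rewrite pnatr_eq0.
Qed.

Lemma antideriv0 Q : (antideriv Q).[0] = 0.
Proof.
rewrite /antideriv horner_sum big1 // => i _.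
by rewrite hornerZ hornerXn exprS mul0r mulr0.
Qed.

Lemma antideriv1 Q : (antideriv Q).[1] = \sum_(i < size Q) Q`_i / i.+1%:R.
Proof.
rewrite /antideriv horner_sum; apply: eq_bigr => i _.
by rewrite hornerZ hornerXn expr1n mulr1.
Qed.

Definition cubic : {poly int} := 'X * (1 - 'X) * (1 - 2%:R *: 'X).

Lemma size_cubic : (size cubic <= 4)%N.
Proof.
apply: leq_trans (size_polyMleq _ _) _.
have h1 : (size (1 - 'X : {poly int})%R <= 2)%N.
  by apply: leq_trans (size_polyD _ _) _; rewrite size_polyN size_polyX size_poly1.
have h2 : (size (1 - 2%:R *: 'X : {poly int})%R <= 2)%N.
  apply: leq_trans (size_polyD _ _) _; rewrite size_polyN geq_max size_poly1 /=.
  by apply: leq_trans (size_scale_leq _ _) _; rewrite size_polyX.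
have h3 : (size ('X * (1 - 'X) : {poly int})%R <= 3)%N.
  by apply: leq_trans (size_polyMleq _ _) _; rewrite size_polyX; lia.
lia.
Qed.

Lemma size_cubic_exp k : (size (cubic ^+ k) <= (3 * k).+1)%N.
Proof.
apply: leq_trans (size_poly_exp_leq _ _) _; have := size_cubic; nia.
Qed.

Lemma horner_cubic (c : R) :
  (map_poly intr cubic).[c] = c * (1 - c) * (1 - 2 * c).
Proof.
rewrite /cubic !rmorphM !rmorphB /= rmorph1 map_polyZ map_polyX.
by rewrite !hornerE.
Qed.

(* The integral over [0, 1] of (x (1 - x) (1 - 2 x)) ^ (2 k) is at most
   108 ^ - k, and it is a positive integer divided by [lcm_upto (6 k + 1)]. *)
Lemma lcm_upto_ge k : (108 ^ k <= lcm_upto (6 * k).+1)%N.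
Proof.
pose q : {poly int} := cubic ^+ (2 * k); pose Q : {poly R} := map_poly intr q.
pose F := antideriv Q.
have Qc c : Q.[c] = ((c * (1 - c) * (1 - 2 * c)) ^+ 2) ^+ k.
  by rewrite /Q /q rmorphXn horner_exp horner_cubic exprM.
(* The integrand vanishes at 1/2, so positivity of the integral is obtained from the mean value
   theorem on each half of the interval. *)
have Q0 c : c \in `]0, 1[ -> c != 2^-1 -> 0 < Q.[c].
  rewrite in_itv /= => /andP[c0 c1] c2; rewrite Qc exprn_gt0 // exprn_even_gt0 //=.
  have h : 1 - 2 * c != 0 by apply: contra c2 => /eqP h; apply/eqP; lra.
  by rewrite !mulf_neq0 //; [lra|lra].
have Fpos : 0 < F.[1].
  have h0 : 0 < 2^-1 :> R by rewrite invr_gt0.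
  have h1 : 2^-1 < 1 :> R by lra.
  have [c1] := poly_mvt F h0; have [c2] := poly_mvt F h1.
  rewrite !in_itv /= deriv_antideriv antideriv0 => /andP[a1 a2] e1 /andP[b1 b2] e2.
  have p1 : 0 < Q.[c1] * (2^-1 - 0).
    by rewrite mulr_gt0 ?subr_gt0 // Q0 ?in_itv /= ?b1 ?(lt_trans b2) ?(lt_eqF b2).
  have p2 : 0 < Q.[c2] * (1 - 2^-1).
    by rewrite mulr_gt0 ?subr_gt0 // Q0 ?in_itv /= ?a2 ?(lt_trans h0 a1) // gt_eqF.
  lra.
have Fle : F.[1] <= 108^-1 ^+ k.
  have [c] := poly_mvt F ltr01.
  rewrite in_itv /= deriv_antideriv antideriv0 !subr0 mulr1 => /andP[c0 c1] ->.
  rewrite Qc lerXn2r ?nnegrE ?sqr_ge0 ?invr_ge0 ?ler0n //.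
  (* With u = c (1 - c) the square is u^2 (1 - 4 u), whose maximum for u >= 0 is 1/108, at u = 1/6;
     this product is the difference from the maximum. *)
  have : 0 <= (c * (1 - c) - 6^-1) ^+ 2 * (4 * (c * (1 - c)) + 3^-1).
    by rewrite mulr_ge0 ?sqr_ge0 // addr_ge0 ?mulr_ge0 ?invr_ge0 ?ler0n // ?subr_ge0 ltW.
  have -> : (c * (1 - c) - 6^-1) ^+ 2 * (4 * (c * (1 - c)) + 3^-1) =
    108^-1 - (c * (1 - c) * (1 - 2 * c)) ^+ 2 by field.
  by rewrite subr_ge0.
have Fint : exists z : int, (lcm_upto (6 * k).+1)%:R * F.[1] = z%:~R.
  exists (\sum_(i < size Q) q`_i * (lcm_upto (6 * k).+1 %/ i.+1)%:Z).
  rewrite antideriv1 mulr_sumr rmorph_sum; apply: eq_bigr => i _ /=.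
  have iL : (i.+1 %| lcm_upto (6 * k).+1)%N.
    apply: dvdn_lcm_upto; rewrite /= (_ : 6 * k = 3 * (2 * k))%N; last by rewrite mulnA.
    apply: leq_trans (ltn_ord i) _; apply: leq_trans (size_poly _ _) _.
    exact: size_cubic_exp.
  rewrite rmorphM /= coef_map /= mulrCA; congr (_ * _).
  rewrite -[X in X%:R / _](divnK iL) natrM mulfK ?pnatr_eq0 //.
have [z zE] := Fint; have L0 : 0 < (lcm_upto (6 * k).+1)%:R :> R.
  by rewrite ltr0n lcm_upto_gt0.
have : 0 < z%:~R :> R by rewrite -zE mulr_gt0.
rewrite ltr0z gtz0_ge1 -(ler_int R) -zE => zge.
rewrite -(ler_nat R) natrX -[leLHS]mul1r -ler_pdivlMr ?exprn_gt0 //.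
by apply: le_trans zge _; rewrite -exprVn ler_wpM2l // ltW.
Qed.

End Antiderivative.

(** * Upper bounds for products of primes and prime powers *)

Section Primorial.
Local Open Scope nat_scope.

Lemma prod_primes_dvdn m n x : (forall p, m <= p < n -> prime p -> p %| x) ->
  \prod_(m <= p < n | prime p) p %| x.
Proof.
elim: n => [|n IH] h; first by rewrite big_geq.
have [nm|mn] := leqP n.+1 m; first by rewrite big_geq.
rewrite big_mkcond big_nat_recr //= -big_mkcond /=.
have hn : \prod_(m <= p < n | prime p) p %| x by apply: IH => p hp; apply: h; lia.
case: ifP => [pn|_]; last by rewrite muln1.
rewrite Gauss_dvd ?hn /= ?h //; first by lia.
rewrite coprime_sym prime_coprime // Euclid_dvd_prod // big_has_cond /=.
apply/hasPn => p; rewrite mem_index_iota => hp; apply/andP => -[pp].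
by move/(dvdn_leq (prime_gt0 pp)); lia.
Qed.

Lemma prime_dvd_fact p m : prime p -> (p %| m`!) = (p <= m).
Proof.
move=> pp; elim: m => [|m IH]; first by rewrite dvdn1 leqNgt; have := prime_gt1 pp; lia.
rewrite factS Euclid_dvdM // IH; apply/orP/idP => [[/dvdn_leq->//|]|]; first by lia.
by rewrite leq_eqVlt => /orP[/eqP->|]; [left | right].
Qed.

Definition primorial n := \prod_(1 <= p < n.+1 | prime p) p.

(** The primes from m + 2 to 2 m + 1 divide (2 m + 1)! but neither m! nor (m + 1)!, hence they
    divide the binomial coefficient. *)
Lemma primorial_double m : primorial (2 * m).+1 <= primorial m.+1 * 'C((2 * m).+1, m).
Proof.
rewrite /primorial (@big_cat_nat _ _ _ m.+2) //=; last lia.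
rewrite leq_mul2l dvdn_leq ?orbT // ?bin_gt0 ?prod_primes_dvdn //; first by lia.
move=> p hp pp; have mm : m <= (2 * m).+1 by lia.
have : p %| (2 * m).+1`! by rewrite dvdn_fact //; lia.
rewrite -(bin_fact mm) !Euclid_dvdM // !prime_dvd_fact //.
by case/or3P => //; lia.
Qed.

(** Two equal middle coefficients occur in the expansion of (1 + 1) ^ (2 m + 1). *)
Lemma bin_odd_le m : 'C((2 * m).+1, m) <= 4 ^ m.
Proof.
have e := expnDn 1 1 (2 * m).+1.
have mm : m < (2 * m).+2 by lia.
have mm' : m.+1 < (2 * m).+2 by lia.
move: e; rewrite (bigD1 (Ordinal mm)) //= (bigD1 (Ordinal mm')) /=; last first.
  by apply/eqP => /(congr1 val) /=; lia.
rewrite !exp1n !muln1 addn1 expnS (expnM 2 2) -[2 ^ 2]/4.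
have -> : 'C((2 * m).+1, m.+1) = 'C((2 * m).+1, m).
  by rewrite -bin_sub; [congr 'C(_, _); lia | lia].
set X := (4 ^ m). set Y := (\sum_(_ < _ | _) _). lia.
Qed.

Lemma primorial_le n : primorial n <= 4 ^ n.
Proof.
have [m] := ubnP n; elim: m n => // m IH [|[|[|n]]] hn.
- by rewrite /primorial big_geq.
- by rewrite /primorial big_mkcond big_nat1.
- by rewrite /primorial big_mkcond big_nat_recr // big_nat1.
have [on|en] := boolP (odd n.+3).
  have [h e] : exists h, n.+3 = (2 * h).+1.
    by exists (n.+3)./2; have := odd_double_half n.+3; rewrite on; lia.
  rewrite e; apply: leq_trans (primorial_double _) _.
  rewrite (_ : 4 ^ _ = 4 ^ h.+1 * 4 ^ h); last by rewrite -expnD; congr (4 ^ _); lia.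
  by rewrite leq_mul ?bin_odd_le //; apply: IH; lia.
have -> : primorial n.+3 = primorial n.+2.
  rewrite /primorial big_mkcond big_nat_recr //= -big_mkcond /=.
  case: ifP => // pn; rewrite ?muln1 //.
  by case: (even_prime pn) => [//|on]; rewrite on in en.
by apply: leq_trans (IH _ _) _; rewrite ?leq_exp2l //; lia.
Qed.

Lemma logn_lcm_upto p n : prime p -> p ^ logn p (lcm_upto n) <= maxn 1 n.
Proof.
move=> pp; elim: n => [|n IH]; first by rewrite /lcm_upto big_nil logn1.
have -> : maxn 1 n.+1 = n.+1 by lia.
rewrite lcm_uptoS logn_lcm ?lcm_upto_gt0 //.
case: (leqP (logn p (lcm_upto n)) (logn p n.+1)) => _.
  by apply: dvdn_leq; rewrite // pfactor_dvdnn.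
by apply: leq_trans IH _; lia.
Qed.

(* [lcm_upto n] divides [q] times its own part on the primes up to [m]. *)
Lemma lcm_upto_le q n m s : 0 < n -> 0 < q -> n < s.+1 ^ 2 -> s <= m ->
  (forall p, prime p -> m < p <= n -> p %| q) ->
  lcm_upto n <= q * (n ^ s * 4 ^ m).
Proof.
move=> n0 q0 ns sm hq; set L := lcm_upto n.
have L0 : 0 < L by apply: lcm_upto_gt0.
pose X := \prod_(1 <= p < m.+1 | prime p) p ^ logn p L.
(* The square of a prime above [s] exceeds n, so such a prime divides the lcm at most once. *)
have log1 p : prime p -> s < p -> logn p L <= 1.
  move=> pp sp; rewrite leqNgt; apply/negP => l2.
  have := logn_lcm_upto n pp; rewrite (maxn_idPr _) // -/L.
  have : p ^ 2 <= p ^ logn p L by rewrite (leq_pexp2l (prime_gt0 pp)).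
  have : s.+1 ^ 2 <= p ^ 2 by rewrite leq_exp2r.
  lia.
have X0 : 0 < X by apply: prodn_cond_gt0 => p pp; rewrite expn_gt0 prime_gt0.
have XL : L %| q * X.
  apply/dvdn_partP => // p; rewrite mem_primes => /and3P[pp _ pL]; rewrite p_part.
  have [pm|mp] := leqP p m.
    apply: dvdn_mull; rewrite /X big_mkcond (bigD1_seq p) ?iota_uniq ?mem_index_iota /= ?pp //.
      exact: dvdn_mulr.
    by rewrite prime_gt0 // ltnS.
  apply: dvdn_mulr; have := log1 p pp (leq_ltn_trans sm mp).
  have : 0 < logn p L by rewrite logn_gt0 mem_primes pp L0.
  move=> l0 l1; have -> : logn p L = 1 by lia.
  rewrite expn1 hq // mp /=; have := logn_lcm_upto n pp; rewrite (maxn_idPr _) // -/L.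
  by move=> h; apply: leq_trans _ h; rewrite -{1}(expn1 p) (leq_pexp2l (prime_gt0 pp)).
apply: leq_trans (dvdn_leq _ XL) _; first by rewrite muln_gt0 q0.
rewrite leq_mul2l; apply/orP; right.
(* Each of the at most [s] primes up to [s] contributes at most n; the larger ones contribute at
   most themselves, hence at most [primorial m] in all. *)
rewrite /X (@big_cat_nat _ _ _ s.+1) //=; apply: leq_mul.
  rewrite big_mkcond /=; apply: (@leq_trans (\prod_(1 <= p < s.+1) n)).
    apply: leq_prod => p _; case: ifP => // pp.
    by have := logn_lcm_upto n pp; rewrite (maxn_idPr _).
  by rewrite prod_nat_const_nat subSS subn0.
apply: leq_trans _ (primorial_le m).
apply: (@leq_trans (\prod_(s.+1 <= p < m.+1 | prime p) p)).
  rewrite big_nat_cond [leqRHS]big_nat_cond; apply: leq_prod => p /andP[/andP[sp _] pp].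
  by rewrite -[leqRHS]expn1 (leq_pexp2l (prime_gt0 pp)) ?log1.
rewrite /primorial [leqRHS](@big_cat_nat _ _ _ s.+1) //= leq_pmull //.
by apply: prodn_cond_gt0 => p /prime_gt0.
Qed.

End Primorial.

(** * Large primes in the denominator of H_n *)

Lemma prod_mul_sum_inv (F : numFieldType) (s : seq nat) (P : pred nat) :
  {in s, forall i, 0 < i}%N ->
  exists B : nat, (\prod_(i <- s | P i) i)%:R * \sum_(i <- s | P i) i%:R^-1 = B%:R :> F.
Proof.
elim: s => [|x s IH] h; first by exists 0%N; rewrite !big_nil mulr0.
have [|B eB] := IH; first by move=> i si; apply: h; rewrite inE si orbT.
rewrite !big_cons; case: ifP => _; last by exists B.
have x0 : x%:R != 0 :> F by rewrite pnatr_eq0 -lt0n h // inE eqxx.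
exists (\prod_(j <- s | P j) j + x * B)%N.
by rewrite natrD !natrM -eB mulrDr mulrAC divff // mul1r mulrA.
Qed.

Lemma sum_inv_multiples (F : fieldType) p n : (0 < p)%N ->
  \sum_(1 <= i < n.+1 | (p %| i)%N) i%:R^-1 =
  p%:R^-1 * \sum_(1 <= l < (n %/ p).+1) l%:R^-1 :> F.
Proof.
move=> p0; rewrite -big_filter mulr_sumr.
rewrite (perm_big [seq (p * l)%N | l <- index_iota 1 (n %/ p).+1]) /=.
  by rewrite big_map; apply: eq_bigr => l _; rewrite natrM invfM.
apply: uniq_perm; rewrite ?filter_uniq ?iota_uniq //.
  by rewrite map_inj_uniq ?iota_uniq // => x y /eqP; rewrite eqn_pmul2l // => /eqP.
move=> i; rewrite mem_filter mem_index_iota; apply/idP/mapP => [/and3P[/dvdnP[l ->] l0 ln]|[l]].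
  exists l; last by rewrite mulnC.
  rewrite mem_index_iota ltnS leq_divRL // -(ltnS _ n) ln andbT.
  by move: l0; rewrite muln_gt0 => /andP[].
rewrite mem_index_iota ltnS leq_divRL // => /andP[l0 ln] ->.
by rewrite dvdn_mulr //= muln_gt0 p0 l0 ltnS mulnC.
Qed.

Definition harmonic_rat n : rat := \sum_(1 <= i < n.+1) i%:R^-1.

(** The terms divisible by p sum to H_j / p with j = n / p rounded down, and the others have a
    common denominator D prime to p. The numerator C = j! H_j is positive and at most J! J < p, so
    the factor p in the denominator does not cancel. *)
Lemma prime_dvd_denq_harmonic J p n : prime p -> (p <= n)%N -> (n < J * p)%N ->
  (J`! * J < p)%N -> (p %| `|denq (harmonic_rat n)|)%N.
Proof.
move=> pp pn nJ Jp; have p0 := prime_gt0 pp.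
set j := (n %/ p)%N; have j0 : (0 < j)%N by rewrite divn_gt0.
have jJ : (j < J)%N by rewrite ltn_divLR.
have hE : harmonic_rat n = p%:R^-1 * harmonic_rat j +
    \sum_(1 <= i < n.+1 | ~~ (p %| i)%N) i%:R^-1.
  by rewrite /harmonic_rat (bigID (fun i => p %| i)%N) /= sum_inv_multiples.
have pos m : {in index_iota 1 m.+1, forall i, 0 < i}%N.
  by move=> i; rewrite mem_index_iota => /andP[].
have [B eB] := prod_mul_sum_inv rat (fun i => ~~ (p %| i)%N) (pos n).
have [C eC] := prod_mul_sum_inv rat xpredT (pos j).
rewrite -/(harmonic_rat j) in eC.
set D := (\prod_(1 <= i < n.+1 | _) i)%N in eB.
have fj : (\prod_(1 <= i < j.+1) i = j`!)%N by rewrite fact_prod.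
rewrite fj in eC; set S := \sum_(1 <= i < n.+1 | _) _ in eB hE.
have pD : coprime p D.
  rewrite prime_coprime // Euclid_dvd_prod // big_has_cond.
  by apply/hasPn => i _ /=; case: (p %| i)%N.
have hj : 0 < harmonic_rat j <= j%:R.
  rewrite /harmonic_rat big_add1 big_mkord /=; apply/andP; split.
    case: (j) j0 => // j' _; rewrite big_ord_recl /= invr1 ltr_pwDl ?ltr01 //.
    by apply: sumr_ge0 => i _; rewrite invr_ge0 ler0n.
  rewrite -[X in _ <= X%:R]card_ord -sumr_const; apply: ler_sum => i _.
  by rewrite invf_le1 ?ler1n ?ltr0n.
have pC : coprime p C.
  have C0 : (0 < C)%N.
    by rewrite -(ltr_nat rat) -eC mulr_gt0 ?ltr0n ?fact_gt0 //; case/andP: hj.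
  rewrite prime_coprime //; apply/negP => /(dvdn_leq C0); apply/negP; rewrite -ltnNge.
  apply: leq_ltn_trans Jp; rewrite -(ler_nat rat) -eC natrM ler_pM ?ler0n //.
  - by case/andP: hj => /ltW.
  - rewrite ler_nat; apply: dvdn_leq; rewrite ?fact_gt0 //.
    have := bin_fact (ltnW jJ) => <-; by rewrite mulnCA dvdn_mulr.
  - by case/andP: hj => _ /le_trans; apply; rewrite ler_nat ltnW.
set h := harmonic_rat n in hE *.
have pn0 : p%:R != 0 :> rat by rewrite pnatr_eq0 -lt0n.
have e : (p * j`! * D)%:R * numq h = denq h * (D * C + p * j`! * B)%:R.
  apply: (@intr_inj rat); rewrite !rmorphM /= !rmorph_nat.
  have -> : (numq h)%:~R = h * (denq h)%:~R :> rat by rewrite numqE.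
  rewrite mulrCA mulrA; rewrite mulrC; congr (_ * _).
  rewrite {1}hE natrD !natrM -eB -eC; field.
  exact: pn0.
(* Every other term of [e] is a multiple of p, and D C is prime to p, so p must divide the
   denominator. *)
have : (p%:Z %| denq h * (D * C)%:Z)%Z.
  have -> : denq h * (D * C)%:Z = p%:Z * (j`!%:Z * (D%:Z * numq h - denq h * B%:Z)).
    move: e; rewrite !natz !PoszD !PoszM; lia.
  exact: dvdz_mulr.
rewrite Gauss_dvdzl // coprimezE /= coprimeMr; exact/andP.
Qed.

(** * Numerical growth estimates *)

Lemma exp_dominates t : (2400 <= t)%N -> exists2 u, (t <= 2 ^ u)%N & (200 * u <= t)%N.
Proof.
(* The bound 2400 is 12 * 200, as 200 (v + 1) <= 2 ^ v holds from v = 12 on. *)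
move=> t0; exists (t %/ 200)%N; last by lia.
have h v : (12 <= v)%N -> (200 * v.+1 <= 2 ^ v)%N.
  elim: v => // v IH; rewrite leq_eqVlt => /orP[/eqP<-|/IH]; first by [].
  by rewrite expnS; lia.
by apply: leq_trans (h _ _); lia.
Qed.

Lemma exists_sqrtn n : exists2 s, (s ^ 2 <= n)%N & (n < s.+1 ^ 2)%N.
Proof.
elim: n => [|n [s h1 h2]]; first by exists 0%N.
have [h|h] := leqP (s.+1 ^ 2) n.+1; last by exists s => //; apply: leqW.
by exists s.+1 => //; apply: leq_ltn_trans h2 _; nia.
Qed.

Lemma bin_le_exp2 m i : ('C(m, i) <= 2 ^ m)%N.
Proof.
have [im|mi] := leqP i m; last by rewrite bin_small.
have e := expnDn 1 1 m; rewrite addn1 in e; rewrite e.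
have im' : (i < m.+1)%N by [].
by rewrite (bigD1 (Ordinal im')) //= !exp1n !muln1 leq_addr.
Qed.

(* Stated for variables so that no unary numeral of this size is computed. *)
Lemma leq_exp27_exp4 a b : (a ^ 9 * (a ^ 9 * a ^ 9) <= b * (b * (b * b)))%N ->
  (a ^ 27 <= b ^ 4)%N.
Proof. by rewrite -!expnD (_ : b * _ = b ^ 4)%N // !expnS expn0 muln1. Qed.

(** This says that 108 ^ (1 / 6) is at least 2 ^ (9 / 8), which leaves a factor 2 ^ (n / 24) over 2
    ^ (13 n / 12) for the polynomial and n ^ s terms. *)
Lemma exp2_27_le : (2 ^ 27 <= 108 ^ 4)%N.
Proof.
apply (@leq_exp27_exp4 2 108).
have -> : (2 ^ 9 = 512)%N by [].
have e : (512 * (512 * 512) <= 108 * (108 * (108 * 108)))%N by lia.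
exact e.
Qed.

Lemma leq_exp27M a b c k : (0 < k)%N -> (a ^ 27 <= b ^ 4)%N -> (b ^ k <= c)%N ->
  (a ^ (27 * k) <= c ^ 4)%N.
Proof.
move=> k0 ab bc; rewrite expnM; apply: (@leq_trans ((b ^ 4) ^ k)).
  by rewrite leq_exp2r.
by rewrite -expnM mulnC expnM leq_exp2r.
Qed.

(* [108 ^ (1 / 6)] exceeds [2 ^ (1 + 1 / 12)]. *)
Lemma growth_gap n s k : (2400 <= s)%N -> (s ^ 2 <= n)%N -> (n < s.+1 ^ 2)%N ->
  (n <= 6 * k.+1)%N -> (n * 2 ^ n * (n ^ s * 4 ^ (n %/ 24)) < 108 ^ k)%N.
Proof.
move=> s0 sn ns nk; rewrite ltnNge; apply/negP => h.
have [u su us] := exp_dominates (leqW s0).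
have n2 : (n <= 2 ^ (2 * u))%N.
  by apply: leq_trans (ltnW ns) _; rewrite mulnC expnM leq_exp2r.
pose v := (2 * u * s.+1)%N.
have h1 : (108 ^ k <= 2 ^ (v + n + 2 * (n %/ 24)))%N.
  apply: leq_trans h _; rewrite (expnD 2 (v + n)) (expnD 2 v) (expnM 2 2) mulnA leq_mul //.
  by rewrite mulnAC -expnS leq_mul // /v expnM leq_exp2r.
have n0 : (2400 * 2400 <= n)%N by apply: leq_trans sn; rewrite -mulnn leq_mul.
have k0 : (0 < k)%N by lia.
have h2 : (27 * k <= (v + n + 2 * (n %/ 24)) * 4)%N.
  by have := leq_exp27M k0 exp2_27_le h1; rewrite -expnM leq_exp2l.
(* Since 27 k is at least 9 n / 2 - 27, comparing exponents leaves n <= 24 v + 162, whereas [v] is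
   at most (s + 1)^2 / 100, about n / 100. *)
have h3 : (24 * v + 162 >= n)%N by lia.
have h4 : (200 * v <= 2 * (s.+1 * s.+1))%N by rewrite /v; nia.
have : (s * s <= n)%N by rewrite mulnn.
nia.
Qed.

(** * Almost covers of the hypercube *)

From mathcomp Require Import finmap multiset.
From mathcomp Require Import boolp classical_sets cardinality reals.

Local Open Scope classical_set_scope.

Section Hypercube.
Variables (R : realType) (n : nat).

Definition indicator_row (z : {set 'I_n}) : 'rV[R]_n := \row_i (i \in z)%:R.

Lemma cube_indicator_row z : cube (indicator_row z).
Proof. by move=> i; rewrite mxE; case: (i \in z); [right | left]. Qed.

Lemma indicator_row_neq0 z : z != finset.set0 -> indicator_row z != 0.
Proof.
move=> /set0Pn[i iz]; apply/eqP => /rowP/(_ i); rewrite !mxE iz => /eqP.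
by rewrite oner_eq0.
Qed.

(** Avoiding the origin means b is nonzero, so the equation can be scaled to right-hand side 1. *)
Lemma affine_hyperplane_setw (H : set 'rV[R]_n) : affine_hyperplane H -> ~ H 0 ->
  exists a : 'I_n -> R, forall z, (indicator_row z \in H) = (setw a z == 1).
Proof.
move=> [a [b [_ ->]]] /= b0; have {}b0 : b != 0.
  apply: contra_not_neq b0 => ->; apply: big1 => i _; by rewrite mxE mulr0.
exists (fun i => a 0 i / b) => z.
have -> : setw (fun i => a 0 i / b) z = (\sum_(i < n) a 0 i * indicator_row z 0 i) / b.
  rewrite /setw big_mkcond mulr_suml; apply: eq_bigr => i _; rewrite mxE.
  by case: (i \in z); rewrite ?mulr1 // mulr0 mul0r.
apply/idP/eqP; first by rewrite inE /= => ->; rewrite divff.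
by move=> e; rewrite inE /=; apply: (divIf b0); rewrite e divff.
Qed.

Lemma min_almost_cover_size_dichotomy k : (0 < n)%N ->
  let m := (min_almost_cover_size R n k)%:R : R in
  let h := k%:R * harmonic_number R n in
  m = h \/ h + (n * 'C(n.-1, n./2))%:R^-1 <= m.
Proof.
move=> n0; rewrite /min_almost_cover_size; case: ex_minnP => _ /asboolP[A [[Ah Ac] <-]] _.
have T0 : (0 < #|'I_n|)%N by rewrite card_ord.
have nf : 0 < n`!%:R :> R by rewrite ltr0n fact_gt0.
have D0 : 0 < (n * 'C(n.-1, n./2))%:R :> R.
  rewrite ltr0n muln_gt0 n0 bin_gt0; case: (n) n0 => //= p _; rewrite uphalf_half; lia.
have := @lubell_cover R 'I_n _ A (fun H z => indicator_row z \in H) k T0.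
case=> [H HA|z z0||[y y0]].
- by have [] := Ah H HA; apply: affine_hyperplane_setw.
- by apply: Ac; [exact: cube_indicator_row | exact: indicator_row_neq0].
- move=> /(congr1 (fun i => i%:R : R)); rewrite !natrM sum_lubell_weight card_ord.
  rewrite mulrCA mulrC => /(mulfI (lt0r_neq0 nf)) e; left; exact: e.
rewrite -(ler_nat R) natrD (natrM R (size A)) (natrM R k) sum_lubell_weight card_ord.
have := fact_le_lubell_weight y0; rewrite -(ler_nat R) (natrM R (lubell_weight y)) card_ord.
move=> h1 h2; right; rewrite -(ler_pM2r nf); apply: le_trans h2.
rewrite mulrDl lerD //; first by rewrite mulrAC -mulrA.
by rewrite mulrC ler_pdivrMr.
Qed.

Lemma min_almost_cover_size_gap k :
  let h := k%:R * harmonic_number R n in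
  0 < (Num.ceil h)%:~R - h < (n * 'C(n.-1, n./2))%:R^-1 ->
  Num.ceil h + 1 <= (min_almost_cover_size R n k)%:Z.
Proof.
(* For n = 0 the upper bound is the inverse of 0, which is 0 by convention, so the hypothesis
   fails. *)
move=> h /andP[c0 c1]; have n0 : (0 < n)%N.
  by rewrite lt0n; apply: contraTneq c1 => ->; rewrite mul0n invr0 -leNgt ltW.
rewrite -ltzD1 ltrD2r -(ltr_int R).
have D0 : 0 < (n * 'C(n.-1, n./2))%:R^-1 :> R by apply: lt_trans c1.
have [e|] := min_almost_cover_size_dichotomy k n0; last first.
  by rewrite -/h -[_%:Z%:~R]/(_%:R); lra.
have : Num.ceil h = (min_almost_cover_size R n k)%:Z.
  by rewrite -[h]e pmulrn intrKceil.
by move=> ce; exfalso; move: c0; rewrite ce -pmulrn e -/h subrr ltxx.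
Qed.

End Hypercube.

(** * Infinitely many k for large n *)

Lemma denq_harmonic_large (R : rcfType) :
  exists N, forall n, (N <= n)%N ->
    (0 < n * 'C(n.-1, n./2) < `|denq (harmonic_rat n)|)%N.
Proof.
(* The first summand makes every prime above n / 24 satisfy the size condition of
   [prime_dvd_denq_harmonic]; the second puts the square root of n above 2400. The factorial is then
   generalized to [K] to keep it from being computed. *)
exists (24 * (24`! * 24) + 2400 * 2400)%N => n nN.
move: nN (@prime_dvd_denq_harmonic 24); move: (24`! * 24)%N => K nN dvd.
have [s sn ns] := exists_sqrtn n.
have s0 : (2400 <= s)%N.
  rewrite -ltnS -(@ltn_exp2r _ _ 2) //; apply: leq_ltn_trans ns.
  by rewrite -mulnn; lia.
have n0 : (0 < n)%N by lia.
(* The exponent [n.-1 %/ 6] is the largest k with 6 k + 1 <= n, the index in [lcm_upto_ge]. *)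
have n1 : ((6 * (n.-1 %/ 6)).+1 <= n)%N by lia.
have n2 : (n <= 6 * (n.-1 %/ 6).+1)%N by lia.
apply/andP; split.
  by rewrite muln_gt0 n0 bin_gt0; lia.
rewrite ltnNge; apply/negP => qD.
have q0 : (0 < `|denq (harmonic_rat n)|)%N by rewrite absz_gt0 denq_neq0.
have sm : (s <= n %/ 24)%N.
  rewrite leq_divRL //; apply: leq_trans sn.
  by rewrite -mulnn leq_mul2l; apply/orP; right; lia.
have qn : (`|denq (harmonic_rat n)| <= n * 2 ^ n)%N.
  apply: leq_trans qD _; rewrite leq_mul2l; apply/orP; right.
  by apply: leq_trans (bin_le_exp2 _ _) _; rewrite leq_exp2l // leq_pred.
have := growth_gap s0 sn ns n2; rewrite ltnNge => /negP; apply.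
apply: leq_trans (lcm_upto_ge R _) _; apply: leq_trans (leq_lcm_upto n1) _.
apply: leq_trans (@lcm_upto_le _ n _ s n0 q0 ns sm _) _.
  by move=> p pp /andP[mp pn]; apply: dvd => //; lia.
by rewrite leq_mul2r qn orbT.
Qed.

Lemma ratr_harmonic (R : realType) n : harmonic_number R n = ratr (harmonic_rat n).
Proof.
rewrite /harmonic_number /harmonic_rat rmorph_sum /=; apply: eq_bigr => i _.
by rewrite fmorphV /= ratr_nat.
Qed.

Lemma unbounded_infinite_set (A : set nat) :
  (forall M, exists2 k, (M <= k)%N & A k) -> infinite_set A.
Proof.
move=> unb /finite_seqP[s As]; have [k] := unb (\max_(i <- s) i).+1.
rewrite As /= => + sk; apply/negP; rewrite -leqNgt.
exact: (@leq_bigmax_seq _ _ xpredT id).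
Qed.

(* [k] is minus an inverse of the numerator of [H_n] modulo its denominator. *)
Lemma exists_ceil_gap (R : realType) n M : (1 < `|denq (harmonic_rat n)|)%N ->
  exists2 k, (M <= k)%N &
    (Num.ceil (k%:R * harmonic_number R n))%:~R - k%:R * harmonic_number R n =
    (`|denq (harmonic_rat n)|)%:R^-1.
Proof.
set h := harmonic_rat n; set q := `|denq h|%N => q1.
have qE : denq h = q%:Z by rewrite /q gez0_abs // denq_ge0.
have [u [v uv]] := Bezoutz (numq h) (denq h).
have {}uv : u * numq h + v * q%:Z = 1.
  rewrite -qE uv; have := coprime_num_den h.
  by rewrite -coprimezE => /eqP.
(* Adding q t to -u keeps the residue modulo q and lifts k above [M]; then k H_n = z - 1 / q, whose
   ceiling is z. *)
pose t := (M + `|u|)%N; pose z := v + t%:Z * numq h.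
have k0 : 0 <= - u + q%:Z * t%:Z - M%:Z by rewrite /t; nia.
exists (absz (- u + q%:Z * t%:Z)); first by lia.
set k := absz _; have kE : k%:Z = - u + q%:Z * t%:Z by rewrite /k; lia.
have kz : k%:Z * numq h = q%:Z * z - 1 by rewrite kE /z; lia.
have q0 : q%:R != 0 :> R by rewrite pnatr_eq0; lia.
have kH : k%:R * harmonic_number R n = z%:~R - q%:R^-1.
  rewrite ratr_harmonic -/h /ratr qE -pmulrn; apply: (mulIf q0).
  rewrite mulrA divfK // mulrBl mulVf //.
  have := congr1 (fun x : int => x%:~R : R) kz.
  by rewrite !rmorphM rmorphB /= rmorphM /= -!pmulrn => ->; rewrite mulrC.
have /andP[qi0 qi1] : 0 < (q%:R^-1 : R) < 1.
  by rewrite invr_gt0 invf_lt1 ?ltr1n ?ltr0n ?q1; lia.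
rewrite kH (@ceil_def _ _ z); first by rewrite opprB addrC subrK.
rewrite rmorphB /= rmorph1; lra.
Qed.

Theorem theorem4p1 (R : realType) :
  (forall n k : nat, (2 <= k)%N ->
    0 < (Num.ceil (k%:R * harmonic_number R n))%:~R - k%:R * harmonic_number R n
      < ((n * 'C(n.-1, n./2))%:R)^-1 ->
    Num.ceil (k%:R * harmonic_number R n) + 1 <= (min_almost_cover_size R n k)%:Z) /\
  (exists N : nat, forall n : nat, (N <= n)%N ->
    infinite_set [set k : nat | (0 < k)%N /\
      Num.ceil (k%:R * harmonic_number R n) + 1 <= (min_almost_cover_size R n k)%:Z]).
Proof.
split=> [n k _|]; first exact: min_almost_cover_size_gap.
have [N hN] := denq_harmonic_large R; exists N => n /hN /andP[D0 Dq].
apply: unbounded_infinite_set => M.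
(* Searching from [M.+1] also makes k positive. *)
have [|k Mk kE] := @exists_ceil_gap R n M.+1; first exact: leq_ltn_trans Dq.
exists k; first exact: ltnW.
split; first exact: leq_ltn_trans Mk.
apply: min_almost_cover_size_gap; rewrite kE invr_gt0 ltr0n (leq_ltn_trans _ Dq) //=.
by rewrite ltf_pV2 ?posrE ?ltr0n ?ltr_nat // (leq_ltn_trans _ Dq).
Qed.
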